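(* Let $n_0\ge 2$ and let $J_{cs}$ be an $(n_0+1)\times(n_0+1)$ centrosymmetric Jacobi matrix with off-diagonal entries $a(1),\dots,a(n_0)\neq 0$ (notation as in the context). For each $z\in\rho(J^D_{cs})$, $$\mathrm{Schur}_{\ell(\partial G_{cs})}(J_{cs})=\phi_{J_{cs}}(z)\Big(R_{J_{cs}}(z)\,I-\Delta_0\Big),$$ where $$R_{J_{cs}}(z):=1-\frac{P_{n_0}(z)}{\prod_{i=1}^{n_0}a(i)},\qquad \phi_{J_{cs}}(z):=-\frac{\prod_{i=1}^{n_0}a(i)}{P^D_{n_0-1}(z)},\qquad \Delta_0=\begin{pmatrix}1&-1\\ -1&1\end{pmatrix}.$$
   Context: Fix $n_0\ge 2$, complex numbers $a(1),\dots,a(n_0)$, all nonzero, and $b(0),\dots,b(n_0)$ with $b(i)=b(n_0-i)$. $J_{cs}$ is the tridiagonal $(n_0+1)\times(n_0+1)$ matrix with rows and columns indexed by $V(G_{cs})=\{0,\dots,n_0\}$ and entries $J_{cs}(i,i)=b(i)$ for $0\le i\le n_0$, $J_{cs}(i-1,i)=a(i)$ and $J_{cs}(i,i-1)=a(n_0+1-i)$ for $1\le i\le n_0$, all other entries $0$. It is centrosymmetric: $J_{cs}(i,j)=J_{cs}(n_0-i,n_0-j)$. Put $\partial G_{cs}=\{0,n_0\}$. $J^D_{cs}$ is the submatrix of $J_{cs}$ with rows and columns $1,\dots,n_0-1$. $\sigma(\cdot)$ denotes the spectrum and $\rho(\cdot)=\mathbb C\setminus\sigma(\cdot)$ the resolvent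 set. For $0\le k\le n_0+1$, $P_k(z)$ is the determinant of the leading principal $k\times k$ submatrix of $zI-J_{cs}$ (with $P_0=1$). For $0\le k\le n_0-1$, $P^D_k(z)$ is the determinant of the leading principal $k\times k$ submatrix of $zI-J^D_{cs}$ (with $P^D_0=1$). In particular $P^D_{n_0-1}(z)=\det(zI-J^D_{cs})$. With respect to $\ell(\{0,n_0\})\oplus\ell(\{1,\dots,n_0-1\})$, where $\ell(I)$ is the space of functions $I\to\mathbb C$, write $J_{cs}=\begin{pmatrix}S_0&\bar X_0\\ X_0&Q_0\end{pmatrix}$; thus $S_0=b(0)I$ and $Q_0=J^D_{cs}$. For $z\in\rho(J^D_{cs})$ the Schur complement is the $2\times2$ matrix $$\mathrm{Schur}_{\ell(\partial G_{cs})}(J_{cs}):=zI-S_0-\bar X_0(zI-Q_0)^{-1}X_0 .$$ *)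

(* Defs.v *)
From HB Require Import structures.
From mathcomp Require Import all_boot all_order all_algebra.
From mathcomp Require Import reals complex.

Set Implicit Arguments.
Unset Strict Implicit.
Unset Printing Implicit Defensive.

Import Order.TTheory GRing.Theory Num.Theory.
Local Open Scope ring_scope.

(* Sequences a, b are functions on nat; only a 1, ..., a n0 and
   b 0, ..., b n0 are ever read. *)
Definition Jcs (F : fieldType) (n0 : nat) (a b : nat -> F) : 'M[F]_n0.+1 :=
  \matrix_(i, j)
    if i == j then b i
    else if i.+1 == j :> nat then a j
    else if j.+1 == i :> nat then a (n0.+1 - i)%N
    else 0.

(* The two boundary vertices, in the order 0, n0. *)
Definition bdry (n0 : nat) (i : 'I_2) : 'I_n0.+1 :=
  if i == ord0 then ord0 else ord_max.

(* The interior vertices 1, ..., n0 - 1. *)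
Definition inner (n0 : nat) (i : 'I_n0.-1) : 'I_n0.+1 := inord i.+1.

Section Blocks.
Variables (F : fieldType) (n0 : nat) (J : 'M[F]_n0.+1).

Definition S0 : 'M[F]_2 := mxsub (@bdry n0) (@bdry n0) J.
Definition Xbar0 : 'M[F]_(2, n0.-1) := mxsub (@bdry n0) (@inner n0) J.
Definition X0 : 'M[F]_(n0.-1, 2) := mxsub (@inner n0) (@bdry n0) J.
Definition Q0 : 'M[F]_n0.-1 := mxsub (@inner n0) (@inner n0) J.

Definition schur_bdry (z : F) : 'M[F]_2 :=
  z%:M - S0 - Xbar0 *m invmx (z%:M - Q0) *m X0.

End Blocks.

Definition JcsD (F : fieldType) (n0 : nat) (a b : nat -> F) : 'M[F]_n0.-1 :=
  Q0 (Jcs n0 a b).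

Definition spectrum (F : fieldType) (n : nat) (A : 'M[F]_n) : pred F :=
  eigenvalue A.

Definition resolvent_set (F : fieldType) (n : nat) (A : 'M[F]_n) : pred F :=
  [predC spectrum A].

Definition lead_sub (F : fieldType) (n k : nat) (hk : (k <= n)%N)
  (A : 'M[F]_n) : 'M[F]_k := mxsub (widen_ord hk) (widen_ord hk) A.

Definition P (F : fieldType) (n0 : nat) (a b : nat -> F)
  (k : nat) (hk : (k <= n0.+1)%N) (z : F) : F :=
  \det (lead_sub hk (z%:M - Jcs n0 a b)).

Definition PD (F : fieldType) (n0 : nat) (a b : nat -> F)
  (k : nat) (hk : (k <= n0.-1)%N) (z : F) : F :=
  \det (lead_sub hk (z%:M - JcsD n0 a b)).

Definition R_J (F : fieldType) (n0 : nat) (a b : nat -> F) (z : F) : F :=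
  1 - P a b (leqnSn n0) z / \prod_(1 <= i < n0.+1) a i.

Definition phi_J (F : fieldType) (n0 : nat) (a b : nat -> F) (z : F) : F :=
  - (\prod_(1 <= i < n0.+1) a i / PD a b (leqnn n0.-1) z).

Definition Delta0 (F : fieldType) : 'M[F]_2 :=
  \matrix_(i, j) if i == j then 1 else -1.

(* Main.v *)
Require Import Defs.
From HB Require Import structures.
From mathcomp Require Import all_boot all_order all_algebra.
From mathcomp Require Import reals complex.
From mathcomp Require Import zify.

Set Implicit Arguments.
Unset Strict Implicit.
Unset Printing Implicit Defensive.

Import Order.TTheory GRing.Theory Num.Theory.
Local Open Scope ring_scope.

(** Write [M = z - Jcs] and [Q] for its interior block.  Both sides of the
    identity are 2x2 matrices invariant under exchanging the two boundary
    vertices: the right-hand side visibly, the Schur complement because [M] is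
    centrosymmetric, so that reversing all indices leaves every block of [M]
    unchanged ([Jcs_rev], [schur_bdry_rev]).  Hence only the first row
    has to be computed.

    Its diagonal entry is the Schur complement of [Q] in the leading
    [n0 x n0] block of [M], that is, the quotient of their determinants
    [P_{n0}(z) / P^D_{n0-1}(z)] ([det_schur_dr], [schur_bdry00]).

    For its off-diagonal entry, the vertices 0 and [n0] have the single
    interior neighbours 1 and [n0 - 1], so the entry is [- a(1) a(n0)] times
    the corner entry of [Q^-1].  By Cramer's rule that corner entry is a
    cofactor of [Q] divided by [P^D_{n0-1}(z)]; erasing the last row and the
    first column of a tridiagonal matrix leaves a triangular one with the
    superdiagonal on its diagonal, so the cofactor is [a(2) ... a(n0-1)], the
    signs cancelling ([invmx_tridiag_corner], [schur_bdry01]).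

    The product of the [a(i)] being nonzero, [phi (R - 1)] equals
    [P_{n0}(z) / P^D_{n0-1}(z)], while the off-diagonal entries of
    [- phi Delta_0] are [phi]. *)

(** * Determinants and inverses *)

Section MatrixFacts.
Variable F : fieldType.

(** Adding to the left block column the right one multiplied by [- D^-1 C]
    clears [C] without changing the determinant. *)
Lemma det_schur_dr (p q : nat) (A : 'M[F]_p) (B : 'M[F]_(p, q))
    (C : 'M[F]_(q, p)) (D : 'M[F]_q) : D \in unitmx ->
  \det (block_mx A B C D) = \det (A - B *m invmx D *m C) * \det D.
Proof.
move=> uD; set L : 'M_(p + q) := block_mx 1%:M 0 (- (invmx D *m C)) 1%:M.
have detL : \det L = 1 by rewrite det_lblock !det1 mulr1.
rewrite -[LHS]mulr1 -detL -det_mulmx mulmx_block.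
by rewrite !mulmx1 !mulmx0 !add0r !mulmxN !mulmxA mulmxV // mul1mx subrr
           det_ublock.
Qed.

Lemma mulmx_mxsub (n p q p' q' : nat) (s : 'I_n -> 'I_n)
    (f : 'I_p' -> 'I_p) (g : 'I_q' -> 'I_q)
    (A : 'M[F]_(p, n)) (B : 'M[F]_(n, q)) :
  bijective s -> mxsub f s A *m mxsub s g B = mxsub f g (A *m B).
Proof.
move=> bij_s; apply/matrixP=> i j; rewrite !mxE.
rewrite [RHS](reindex s) /=; last exact: onW_bij.
by apply: eq_bigr => k _; rewrite !mxE.
Qed.

Lemma invmx_mxsub (n : nat) (s : 'I_n -> 'I_n) (A : 'M[F]_n) :
  bijective s -> A \in unitmx ->
  invmx (mxsub s s A) = mxsub s s (invmx A).
Proof.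
move=> bij_s uA.
have E : mxsub s s A *m mxsub s s (invmx A) = 1%:M.
  rewrite mulmx_mxsub // mulmxV //.
  by apply/matrixP=> i j; rewrite !mxE (inj_eq (bij_inj bij_s)).
have [uB _] := mulmx1_unit E.
by rewrite -[LHS]mulmx1 -E (mulKmx uB).
Qed.

(** The entry is a cofactor over the determinant; the minor involved is
    lower triangular because [A] vanishes above its superdiagonal.  Writing the
    superdiagonal as [- c] makes the signs of its [m] entries cancel the sign
    [(-1) ^+ m] of the cofactor. *)
Lemma invmx_tridiag_corner (m : nat) (A : 'M[F]_m.+1) (c : nat -> F) :
  A \in unitmx ->
  (forall i j : 'I_m.+1, (i.+1 < j)%N -> A i j = 0) ->
  (forall i j : 'I_m.+1, i.+1 = j :> nat -> A i j = - c j) ->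
  invmx A ord0 ord_max = (\prod_(1 <= i < m.+1) c i) / \det A.
Proof.
move=> uA A0 Ac; rewrite /invmx uA !mxE mulrC /cofactor addn0; congr (_ / _).
rewrite det_trig.
  rewrite (eq_bigr (fun i : 'I_m => - c i.+1)); last first.
    by move=> i _; rewrite !mxE (Ac _ (lift ord0 i)) ?lift0 // lift_max.
  by rewrite prodrN card_ord signrMK big_add1 big_mkord.
apply/is_trig_mxP => i j lt_ij; rewrite !mxE A0 // lift_max.
by rewrite lift0.
Qed.

Lemma resolvent_unitmx (n : nat) (A : 'M[F]_n) (z : F) :
  z \in resolvent_set A -> z%:M - A \in unitmx.
Proof.
rewrite unfold_in /= /spectrum unfold_in negbK /eigenspace.
rewrite kermx_eq0 row_free_unit => uA.
by rewrite -opprB -scaleN1r unitmxZ // unitrN1.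
Qed.

Lemma mxsub_scalar_sub (n k : nat) (s : 'I_k -> 'I_n) (A : 'M[F]_n) (z : F) :
  injective s -> mxsub s s (z%:M - A) = z%:M - mxsub s s A.
Proof. by move=> s_inj; apply/matrixP=> i j; rewrite !mxE (inj_eq s_inj). Qed.

End MatrixFacts.

(** * The Schur complement of a centrosymmetric Jacobi matrix *)

Section CentrosymmetricJacobi.
(* Writing [n0 = m + 2] makes the interior index type ['I_m.+1], for which
   [ord0] and [ord_max] are available. *)
Variables (F : fieldType) (m : nat) (a b : nat -> F) (z : F).
Let n0 := m.+2.
Let J : 'M[F]_n0.+1 := Jcs n0 a b.
Let D : 'M[F]_m.+1 := z%:M - JcsD n0 a b.
Hypothesis uD : D \in unitmx.

Lemma val_inner (k : 'I_m.+1) : inner (n0 := n0) k = k.+1 :> nat.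
Proof. by rewrite inordK // ltnS leqW. Qed.

Lemma inner_inj : injective (@inner n0).
Proof.
move=> i j /(congr1 val) /=; rewrite !val_inner => -[]; exact: val_inj.
Qed.

Lemma PD_det : PD a b (leqnn n0.-1) z = \det D.
Proof.
congr (\det _); apply/matrixP => i j; rewrite [LHS]mxE.
by congr (D _ _); apply: val_inj.
Qed.

Lemma D_sup0 (i j : 'I_m.+1) : (i.+1 < j)%N -> D i j = 0.
Proof.
move=> lt_ij; rewrite !mxE (inj_eq inner_inj) !val_inner -!val_eqE /=.
by do 3 ?case: eqP; try lia; rewrite subr0.
Qed.

Lemma D_sup (i j : 'I_m.+1) : i.+1 = j :> nat -> D i j = - a j.+1.
Proof.
move=> eq_ij; rewrite !mxE (inj_eq inner_inj) !val_inner -!val_eqE /=.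
by do 3 ?case: eqP; try lia; rewrite sub0r.
Qed.

(** The leading [n0 x n0] block of [z - J] consists of the vertex 0 and the
    interior, so its determinant is this entry times [\det D]. *)
Lemma schur_bdry00 :
  schur_bdry J z ord0 ord0 = P a b (leqnSn n0) z / PD a b (leqnn n0.-1) z.
Proof.
have detD : \det D != 0 by rewrite -unitfE -unitmxE.
rewrite PD_det; apply: (canRL (mulfK detD)).
pose M : 'M[F]_(1 + m.+1) := lead_sub (leqnSn n0) (z%:M - J).
have widenE (k : 'I_m.+1) :
    widen_ord (leqnSn n0) (rshift 1 k) = inner (n0 := n0) k.
  by apply: val_inj; rewrite [RHS]val_inner.
have EM : drsubmx M = D.
  rewrite /D /JcsD /Q0 -(mxsub_scalar_sub _ _ inner_inj).
  by apply/matrixP => i j; rewrite !mxE -!widenE.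
have -> : P a b (leqnSn n0) z = \det M by [].
have b0 (k : 'I_m.+1) : (bdry n0 ord0 == inner (n0 := n0) k = false)
                      * (inner (n0 := n0) k == bdry n0 ord0 = false).
  by rewrite -!val_eqE /= val_inner.
have w0 : widen_ord (leqnSn n0) (lshift m.+1 (ord0 : 'I_1)) = bdry n0 ord0.
  exact: val_inj.
have EB : ursubmx M = - row ord0 (Xbar0 J).
  by apply/matrixP => i j; rewrite ord1 ![in LHS]mxE widenE w0 b0 sub0r !mxE b0.
have EC : dlsubmx M = - col ord0 (X0 J).
  by apply/matrixP => i j; rewrite ord1 ![in LHS]mxE widenE w0 b0 sub0r !mxE b0.
rewrite -(submxK M) det_schur_dr EM // EB EC; congr (_ * _).
rewrite det_mx11 mulNmx mulmxN mulNmx opprK -row_mul /schur_bdry.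
rewrite [LHS]mxE [RHS]mxE; congr (_ + _).
  by rewrite ![in RHS]mxE w0 !mxE eqxx.
rewrite ![in LHS]mxE ![in RHS]mxE; congr (- _).
apply: eq_bigr => k _; rewrite [X in _ = X * _]mxE.
by rewrite [X in _ = _ * X]mxE.
Qed.

(** Since the vertex 0 has the only interior neighbour 1, and [n0] the only
    interior neighbour [n0 - 1], the double sum over the interior reduces to a
    single term, the one with the corner entry of the inverse. *)
Lemma schur_bdry01 :
  schur_bdry J z ord0 ord_max = phi_J n0 a b z.
Proof.
rewrite /phi_J PD_det /schur_bdry -/(JcsD n0 a b) -/D.
have X0E (k : 'I_m.+1) :
    X0 J k ord_max = if k == ord_max then a n0 else 0.
  rewrite !mxE -!val_eqE /= val_inner.
  by have := ltn_ord k; do 4 ?case: eqP; try lia.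
have XE (k : 'I_m.+1) :
    Xbar0 J ord0 k = if k == ord0 then a 1%N else 0.
  rewrite !mxE -!val_eqE /= val_inner.
  by have [->|k0] := eqVneq (k : nat) 0%N; do 3 ?case: eqP => //; try lia.
have S01 : (z%:M - S0 J) ord0 ord_max = 0 by rewrite !mxE subrr.
rewrite mxE S01 add0r mxE; congr (- _).
rewrite mxE (bigD1 ord_max) //= big1 => [|k /negPf k_max]; last first.
  by rewrite X0E k_max mulr0.
rewrite mxE (bigD1 ord0) //= big1 => [|k /negPf k0]; last by rewrite XE k0 mul0r.
rewrite XE X0E !eqxx !addr0.
have := invmx_tridiag_corner (c := fun j => a j.+1) uD D_sup0 D_sup.
rewrite {1}/D => ->.
rewrite [in RHS]big_ltn // [in RHS]big_add1 /= [in RHS]big_nat_recr //=.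
by rewrite -!mulrA [a n0 / _]mulrC.
Qed.

End CentrosymmetricJacobi.

Section Reversal.
Variables (F : fieldType) (m : nat).
Let n0 := m.+2.

Lemma bdry_rev (i : 'I_2) : bdry n0 (rev_ord i) = rev_ord (bdry n0 i).
Proof.
apply: val_inj; rewrite /bdry -!val_eqE.
by case: i => [[|[|]]] //= _; rewrite subnn.
Qed.

Lemma inner_rev (k : 'I_m.+1) :
  inner (n0 := n0) (rev_ord k) = rev_ord (inner (n0 := n0) k).
Proof.
apply: val_inj; rewrite /= !val_inner /=.
by have := ltn_ord k; rewrite /n0; lia.
Qed.

(** Reversal permutes the boundary and the interior separately, so it acts on
    the Schur complement by reindexing each of the four blocks. *)
Lemma schur_bdry_rev (J : 'M[F]_n0.+1) (z : F) (i j : 'I_2) :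
  (forall p q, J (rev_ord p) (rev_ord q) = J p q) ->
  z%:M - Q0 J \in unitmx ->
  schur_bdry J z (rev_ord i) (rev_ord j) = schur_bdry J z i j.
Proof.
move=> Jrev uQ.
have rev_bij p : bijective (@rev_ord p) by exists (@rev_ord p); exact: rev_ordK.
have SE : mxsub (@rev_ord 2) (@rev_ord 2) (S0 J) = S0 J.
  by apply/matrixP => p q; rewrite !mxE !bdry_rev Jrev.
have XbarE : mxsub (@rev_ord 2) (@rev_ord m.+1) (Xbar0 J) = Xbar0 J.
  by apply/matrixP => p q; rewrite !mxE bdry_rev inner_rev Jrev.
have XE : mxsub (@rev_ord m.+1) (@rev_ord 2) (X0 J) = X0 J.
  by apply/matrixP => p q; rewrite !mxE bdry_rev inner_rev Jrev.
have QE : mxsub (@rev_ord m.+1) (@rev_ord m.+1) (z%:M - Q0 J) = z%:M - Q0 J.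
  rewrite mxsub_scalar_sub; last exact: rev_ord_inj.
  by congr (_ - _); apply/matrixP => p q; rewrite !mxE !inner_rev Jrev.
have QVE := invmx_mxsub (rev_bij _) uQ; rewrite QE in QVE.
have /matrixP/(_ i j) : mxsub (@rev_ord 2) (@rev_ord 2) (schur_bdry J z)
    = schur_bdry J z; last by rewrite mxE.
rewrite /schur_bdry raddfB /= mxsub_scalar_sub; last exact: rev_ord_inj.
by rewrite SE -!(mulmx_mxsub _ _ _ _ (rev_bij m.+1)) XbarE XE -QVE.
Qed.

End Reversal.

(** Reversal turns the step from [i] to [i.+1] into a step down from
    [n0 - i], whose coefficient is [a (n0.+1 - (n0 - i)) = a i.+1]. *)
Lemma Jcs_rev (F : fieldType) (n0 : nat) (a b : nat -> F) :
  (forall i, (i <= n0)%N -> b i = b (n0 - i)%N) ->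
  forall p q, Jcs n0 a b (rev_ord p) (rev_ord q) = Jcs n0 a b p q.
Proof.
move=> hb p q; have := ltn_ord p; have := ltn_ord q; rewrite !ltnS => leq lep.
rewrite !mxE (inj_eq rev_ord_inj) /= !subSS -hb //.
case: eqP => // _.
have -> : ((n0 - p).+1 == n0 - q)%N = (q.+1 == p) by lia.
have -> : ((n0 - q).+1 == n0 - p)%N = (p.+1 == q) by lia.
have [pq|_] := eqVneq p.+1 q.
  have -> : (q.+1 == p) = false by lia.
  by congr (a _); lia.
by case: eqP => // qp; congr (a _); lia.
Qed.

Theorem theorem3p3 (R : realType) (n0 : nat) (a b : nat -> complex R)
  (hn0 : (2 <= n0)%N)
  (ha : forall i : nat, (1 <= i <= n0)%N -> a i != 0)
  (hb : forall i : nat, (i <= n0)%N -> b i = b (n0 - i)%N)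
  (z : complex R) (hz : z \in resolvent_set (JcsD n0 a b)) :
  schur_bdry (Jcs n0 a b) z =
    phi_J n0 a b z *: ((R_J n0 a b z)%:M - Delta0 (complex R)).
Proof.
case: n0 => [|[|m]] // in hn0 ha hb hz *.
have uD := resolvent_unitmx hz.
have a_neq0 : \prod_(1 <= i < m.+3) a i != 0.
  rewrite prodf_seq_neq0; apply/allP => i /=.
  by rewrite mem_index_iota => /ha.
have rev0 : rev_ord (ord0 : 'I_2) = ord_max by exact: val_inj.
have rev1 : rev_ord (ord_max : 'I_2) = ord0 by exact: val_inj.
have S_rev i j := schur_bdry_rev i j (Jcs_rev a hb) uD.
have diagE : phi_J m.+2 a b z * (R_J m.+2 a b z - 1)
    = schur_bdry (Jcs m.+2 a b) z ord0 ord0.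
  rewrite schur_bdry00 // /phi_J /R_J addrAC subrr add0r mulrNN.
  by rewrite mulrAC mulrCA mulfV // mulr1.
have I2 (i : 'I_2) : i = ord0 \/ i = ord_max.
  by case: i => [[|[|]]] // ?; [left | right]; exact: val_inj.
apply/matrixP => i j; rewrite [RHS]mxE [X in _ * X]mxE [X in X + _]mxE.
rewrite [X in _ + X]mxE [X in _ - X]mxE.
case: (I2 i) (I2 j) => -> [] ->;
  rewrite ?eqxx /= ?mulr1n ?mulr0n ?sub0r ?opprK ?mulr1.
- by rewrite diagE.
- exact: schur_bdry01.
- by rewrite -rev0 -{2}rev1 S_rev schur_bdry01.
- by rewrite diagE -rev0 S_rev.
Qed.
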